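(* Let $f_1,\dots,f_M:\mathbb{R}^n\to\mathbb{R}^n$ be locally Lipschitz with $f_i(0)=0$ for all $i\in\mathcal Q=\{1,\dots,M\}$. Let $(V,W)$ be a CLF pair for the switched system $\dot x(t)=f_{\sigma(t)}(x(t))$, $\sigma(t)\in\mathcal Q$, where $V$ is a piecewise smooth control-Lyapunov function with partition $\{\Omega_j\}_{j\in\{1,\dots,m\}}$, and let $\nu=\mathcal S[V]$ be the switching law generated from $V$. Suppose that for any $x\in\partial\Omega\cap\partial\mathcal D$ there exists $j\in J(x)$ such that $$DV_j(x;f_q(x))\le -W(x)\quad\text{for all } q\in\mathcal M_j^c(x)\cap\mathcal I_{sm}^a(x).$$ Then the closed-loop system $\dot x(t)=f_{\nu(x(t))}(x(t))$ is globally asymptotically stable including sliding motions.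
   Context: Notation: $\mathbb N_m=\{1,\dots,m\}$, $\mathbb R_+=[0,\infty)$, $\mathcal N(x;\delta)=\{z\in\mathbb R^n:\|z-x\|<\delta\}$, $\mu$ is Lebesgue measure, $\overline{co}$ is closed convex hull. Filippov solutions: for $X:\mathbb R^n\to\mathbb R^n$, $F[X](x)=\bigcap_{\delta>0}\bigcap_{\mu(S)=0}\overline{co}\{X(\mathcal N(x;\delta)\setminus S)\}$. A Filippov solution of $\dot x=X(x)$ is an absolutely continuous $x(\cdot)$ with $\dot x(t)\in F[X](x(t))$ for almost all $t$. Piecewise smooth function: $g:\mathbb R^n\to\mathbb R$ is piecewise smooth if it is continuous and there are finitely many disjoint open sets $\Omega_1,\dots,\Omega_m$ such that $\bigcup_j\bar\Omega_j=\mathbb R^n$, $g$ is continuously differentiable on each $\Omega_j$, and each $\partial\Omega_j$ is a differential manifold. Such $g$ has directional derivatives $Dg(x;\eta)=\lim_{\delta\downarrow0}\frac1\delta(g(x+\delta\eta)-g(x))$ for all $x,\eta\in\mathbb R^n$. PSCLF and CLF pair: a piecewise smooth $V:\mathbb R^n\to\mathbb R_+$ is a piecewise smooth control-Lyapunov function (PSCLF), and $(V,W)$ is a CLF pair, if $W:\mathbb R^n\to\mathbb R_+$ is continuous and: $V(x)>0$, $W(x)>0$ for all $x\neq0$, and $V(0)=0$; $\{x:V(x)\le\beta\}$ is bounded for each $\beta$; $\min_{i\in\mathcal Q}DV(x;f_i(x))\le -W(x)$ for all $x\in\mathbb R^n$. Let $\partial\Omega=\bigcup_j\partial\Omega_j$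 and $J(x)=\{j\in\mathbb N_m:x\in\bar\Omega_j\}$. Let $V_j$ be the restriction of $V$ to $\bar\Omega_j$; for $\hat x\in\partial\Omega_j$ set $\nabla V_j(\hat x)=\lim_{x\in\Omega_j,x\to\hat x}\nabla V_j(x)$ (this limit is taken to exist), so that $V_j(z)-V_j(x)=\langle\nabla V_j(x),z-x\rangle+o(\|z-x\|)$ for $x,z\in\bar\Omega_j$; and $DV_j(x;\eta)=\langle\nabla V_j(x),\eta\rangle$ for $x\in\bar\Omega_j$. Switching law $\nu=\mathcal S[V]$: for $j\in\mathbb N_m$, $i\in\mathcal Q$ let $$\mathcal D_{j,i}=\Big\{x\in\Omega_j:\langle\nabla V_j(x),f_i(x)\rangle<\min_{q\in\mathcal Q,q\ne i}\langle\nabla V_j(x),f_q(x)\rangle\Big\},$$ $\mathcal D_i=\bigcup_j\mathcal D_{j,i}$, $\partial\mathcal D=\bigcup_i\partial\mathcal D_i$. Set $\nu(x)=i$ if $x\in\mathcal D_i$, and $\nu(x)=\min\{i\in\mathcal Q:x\in\partial\mathcal D_i\}$ if $x\in\partial\mathcal D$. The sets $\mathcal D_i$ are open and disjoint; it is taken as standing that $\nu$ is admissible, i.e. $\bigcup_i\bar{\mathcal D}_i=\mathbb R^n$, and that $\partial\mathcal D$ has measure zero. For $x\in\partial\Omega_j$, $\mathcal M_j(x)=\{i\in\mathcal Q:\exists\{z_k\}_{k\ge0}\subset\Omega_j\cap\mathcal D_i\text{ with }\lim_{k\to\infty}z_k=x\}$, and $\mathcal M_j^c(x)=\mathcal Q\setminus\mathcal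 M_j(x)$. Sliding motions: write $f_{[\nu]}(x)=f_{\nu(x)}(x)$ and let $x(\cdot;z,\nu):\mathbb R_+\to\mathbb R^n$ denote a Filippov solution of $\dot x=f_{[\nu]}(x)$ with initial state $z$. A sliding motion is a part of the trajectory on a nontrivial interval $(t_1,t_2)$ with $\dot x(t;z,\nu)\ne f_{[\nu]}(x(t;z,\nu))$ for almost all $t\in(t_1,t_2)$; it can occur only on $\partial\mathcal D$. For $x\in\partial\mathcal D$ let $\mathcal I_{sm}(x)=\{i\in\mathcal Q:x\in\partial\mathcal D_i\}$. During a sliding motion the velocity at $x$ is $\dot x=\sum_{i\in\mathcal I_{sm}(x)}\alpha_i(x)f_i(x)$ for convex combination coefficients $\alpha_i(x)\ge0$, $\sum_{i\in\mathcal I_{sm}(x)}\alpha_i(x)=1$. With these coefficients, $\mathcal I_{sm}^a(x)=\{i\in\mathcal I_{sm}(x):\alpha_i(x)\ne0\}$ is the set of active subsystems involved in the sliding motion at $x$ (empty if no sliding motion takes place at $x$). A point $x\in\partial\mathcal D$ is regular if for every $i\in\mathcal I_{sm}^a(x)$ there is $\epsilon_i>0$ with $x-\delta f_i(x)\in\mathcal D_i$ for all $\delta\in(0,\epsilon_i)$. Stability including sliding motions: for $\epsilon>0$ let $\mathcal X_{sm}(\epsilon,\nu)$ be the set of Filippov solutions $x(\cdot;z,\nu)$ with $\|z\|\le\epsilon$ such that, whenever $t_1<t_2$ and $\dot x(t;z,\nu)\ne f_{[\nu]}(x(t;z,\nu))$ for a.e. $t\in(t_1,t_2)$, the point $x(t;z,\nu)$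 is regular for all $t\in(t_1,t_2)$. The closed-loop system is globally asymptotically stable including sliding motions if (i) for any $\epsilon>0$ there is $\delta>0$ such that every $x(\cdot;z,\nu)\in\mathcal X_{sm}(\delta,\nu)$ satisfies $\|x(t;z,\nu)\|<\epsilon$ for all $t\in\mathbb R_+$, and (ii) $\lim_{t\to\infty}x(t;z,\nu)=0$ for every $x(\cdot;z,\nu)\in\mathcal X_{sm}(\rho,\nu)$ and every $\rho>0$.
   Formalization: A sliding motion at x, hence the active set I_sm^a(x), also includes solutions whose sliding times near that instant have positive measure but contain no interval; with intervals only, sliding on a fat Cantor set of times can make V increase and the claim fails. *)

(* Defs.v *)
From HB Require Import structures.
From mathcomp Require Import all_boot all_order all_algebra.
From mathcomp Require Import all_classical all_reals all_analysis.

Set Implicit Arguments.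
Unset Strict Implicit.
Unset Printing Implicit Defensive.

Import Order.TTheory GRing.Theory Num.Theory.
Import numFieldNormedType.Exports.

Local Open Scope classical_set_scope.
Local Open Scope ring_scope.

Section Euclidean.
Context {R : realType} {n : nat}.
Implicit Types (x y u v : 'rV[R]_n) (A S U : set 'rV[R]_n).

Definition dotv u v : R := \sum_(i < n) u 0 i * v 0 i.

(* The library norm on 'rV[R]_n is the sup norm; it induces the same topology. *)
Definition enorm x : R := Num.sqrt (dotv x x).

Definition eball x (r : R) : set 'rV[R]_n := [set z | enorm (z - x) < r].

Definition bd A : set 'rV[R]_n := closure A `\` interior A.

(* Lebesgue-null sets of R^n: covered by countably many closed boxes of
   arbitrarily small total volume. *)
Definition null_set S :=
  forall e : R, 0 < e -> exists a b : nat -> 'rV[R]_n,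
    [/\ forall k i, a k 0 i <= b k 0 i,
        S `<=` \bigcup_k [set x | forall i, a k 0 i <= x 0 i <= b k 0 i]
      & (\sum_(0 <= k <oo) (\prod_(i < n) (b k 0 i - a k 0 i))%:E <= e%:E)%E].

Definition closed_convex_hull A : set 'rV[R]_n :=
  smallest [set C : set 'rV[R]_n | closed C /\ convex_set C] A.

Definition grad (g : 'rV[R]_n -> R) x : 'rV[R]_n :=
  \row_(i < n) 'D_(delta_mx 0 i) g x.

Definition C1_on {K : normedModType R} U (g : 'rV[R]_n -> K) :=
  forall x, U x ->
    differentiable g x /\ forall v, {for x, continuous (fun z => 'D_v g z)}.

(* Embedded C^1 submanifold of R^n (without boundary), of some dimension d:
   near each of its points a C^1 diffeomorphism phi straightens S to the
   coordinate subspace where the coordinates of index >= d vanish. *)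
Definition submanifold S := exists2 d : nat, (d <= n)%N &
  forall x, S x -> exists U (phi psi : 'rV[R]_n -> 'rV[R]_n),
    [/\ open U /\ U x,
        C1_on U phi,
        open (phi @` U) /\ C1_on (phi @` U) psi,
        forall z, U z -> psi (phi z) = z
      & forall z, U z -> (S z <-> forall i : 'I_n, (d <= i)%N -> phi z 0 i = 0)].

Definition dirderiv (g : 'rV[R]_n -> R) x v : R :=
  lim (h^-1 * (g (x + h *: v) - g x) @[h --> 0^'+]).

End Euclidean.

Section Filippov.
Context {R : realType} {n : nat}.
Implicit Types (X : 'rV[R]_n -> 'rV[R]_n) (phi : R -> 'rV[R]_n).

Definition filippov_map X (x : 'rV[R]_n) : set 'rV[R]_n :=
  [set v | forall (delta : R) (S : set 'rV[R]_n), 0 < delta -> null_set S ->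
    closed_convex_hull (X @` (eball x delta `\` S)) v].

Definition abs_continuous (a b : R) phi :=
  forall e : R, 0 < e -> exists2 d : R, 0 < d &
    forall (N : nat) (s t : 'I_N -> R),
      (forall k, [/\ a <= s k, s k <= t k & t k <= b]) ->
      (forall k l, k != l -> t k <= s l \/ t l <= s k) ->
      \sum_(k < N) (t k - s k) < d ->
      \sum_(k < N) enorm (phi (t k) - phi (s k)) < e.

(* Solutions live on [0, +oo); the values of phi at negative times are
   irrelevant. *)
Definition filippov_solution X phi :=
  (forall T : R, 0 <= T -> abs_continuous 0 T phi) /\
  {ae (@lebesgue_measure R), forall t : R, 0 < t ->
     derivable phi t 1 /\ filippov_map X (phi t) (derive1 phi t)}.

End Filippov.

Section ControlLyapunov.
Context {R : realType} {n M m : nat}.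
Variables (f : 'I_M -> 'rV[R]_n -> 'rV[R]_n) (V W : 'rV[R]_n -> R).
Variable Omega : 'I_m -> set 'rV[R]_n.

Definition piecewise_smooth :=
  [/\ continuous V,
      forall j, open (Omega j),
      forall j k, j != k -> Omega j `&` Omega k = set0,
      \bigcup_j closure (Omega j) = [set: 'rV[R]_n]
    & forall j, C1_on (Omega j) V /\ submanifold (bd (Omega j))].

Definition clf_pair :=
  [/\ (forall x, 0 <= V x) /\ (forall x, 0 <= W x),
      continuous W,
      (forall x, x != 0 -> 0 < V x /\ 0 < W x) /\ V 0 = 0,
      forall beta : R, bounded_set [set x | V x <= beta]
    & forall x,
        (\big[Order.min/+oo]_(i < M) (dirderiv V x (f i x))%:E
           <= (- W x)%:E)%E].

Definition has_boundary_gradients :=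
  forall j x, bd (Omega j) x -> cvg (grad V @ within (Omega j) (nbhs x)).

Definition piece_grad (j : 'I_m) (x : 'rV[R]_n) : 'rV[R]_n :=
  if `[< Omega j x >] then grad V x
  else lim (grad V @ within (Omega j) (nbhs x)).

Definition piece_dirderiv (j : 'I_m) (x v : 'rV[R]_n) : R :=
  dotv (piece_grad j x) v.

(* The minimum over the empty family (M = 1) is +oo. *)
Definition Dji (j : 'I_m) (i : 'I_M) : set 'rV[R]_n :=
  [set x | Omega j x /\
    ((dotv (piece_grad j x) (f i x))%:E
       < \big[Order.min/+oo]_(q < M | q != i)
           (dotv (piece_grad j x) (f q x))%:E)%E].

Definition Dset (i : 'I_M) : set 'rV[R]_n := \bigcup_j Dji j i.

Definition bdD : set 'rV[R]_n := \bigcup_i bd (Dset i).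

Definition bdOmega : set 'rV[R]_n := \bigcup_j bd (Omega j).

Definition admissible :=
  \bigcup_i closure (Dset i) = [set: 'rV[R]_n] /\ null_set bdD.

Definition Ism (x : 'rV[R]_n) : set 'I_M := [set i | bd (Dset i) x].

Definition switching_law (nu : 'rV[R]_n -> 'I_M) :=
  (forall i x, Dset i x -> nu x = i) /\
  (forall x, bdD x -> Ism x (nu x) /\ forall i, Ism x i -> (nu x <= i)%N).

Definition Mset (j : 'I_m) (x : 'rV[R]_n) : set 'I_M :=
  [set i | exists2 z : nat -> 'rV[R]_n,
     forall k, (Omega j `&` Dset i) (z k) & z @ \oo --> x].

Section Sliding.
Variable nu : 'rV[R]_n -> 'I_M.

Definition closed_loop (x : 'rV[R]_n) : 'rV[R]_n := f (nu x) x.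

(* v is the velocity of a sliding motion through x: some closed-loop Filippov
   solution passes through x with velocity v <> f_nu(x), at a time around which
   the times s with phi'(s) <> f_nu(phi(s)) are not negligible.  Every such time
   inside an interval of sliding qualifies; in addition, sliding on a
   non-negligible set of times that contains no interval (a fat Cantor set, say)
   counts as sliding. *)
Definition sliding_velocity (x v : 'rV[R]_n) :=
  exists (phi : R -> 'rV[R]_n) (t : R),
    [/\ filippov_solution closed_loop phi,
        0 < t /\ phi t = x,
        derivable phi t 1 /\ derive1 phi t = v,
        v <> closed_loop x
      & forall e : R, 0 < e -> ~ (@lebesgue_measure R).-negligible
          [set s | [/\ 0 < s, `|s - t| < e
                     & derive1 phi s <> closed_loop (phi s)]]].

Section Coefficients.
(* Filippov solutions need not be unique, so several sliding velocities v are
   possible at a point x; the coefficients are indexed by x and v. *)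
Variable alpha : 'rV[R]_n -> 'rV[R]_n -> 'I_M -> R.

Definition sliding_coefficients :=
  forall x v, bdD x -> sliding_velocity x v ->
    [/\ forall i, Ism x i -> 0 <= alpha x v i,
        \sum_(i < M | `[< Ism x i >]) alpha x v i = 1
      & v = \sum_(i < M | `[< Ism x i >]) alpha x v i *: f i x].

Definition Ism_active (x v : 'rV[R]_n) : set 'I_M :=
  [set i | [/\ sliding_velocity x v, Ism x i & alpha x v i != 0]].

Definition regular (x v : 'rV[R]_n) :=
  bdD x /\ forall i, Ism_active x v i -> exists2 e : R, 0 < e &
    forall delta : R, 0 < delta < e -> Dset i (x - delta *: f i x).

Definition slides_on (phi : R -> 'rV[R]_n) (t1 t2 : R) :=
  {ae (@lebesgue_measure R), forall t : R, t1 < t < t2 ->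
     derive1 phi t <> closed_loop (phi t)}.

(* Regularity at time t is tested with the velocity at t, whenever it exists. *)
Definition Xsm (eps : R) : set (R -> 'rV[R]_n) :=
  [set phi | [/\ filippov_solution closed_loop phi,
      enorm (phi 0) <= eps
    & forall t1 t2 : R, 0 <= t1 -> t1 < t2 -> slides_on phi t1 t2 ->
        forall t, t1 < t < t2 -> derivable phi t 1 ->
          regular (phi t) (derive1 phi t)]].

Definition GAS_including_sliding :=
  (forall eps : R, 0 < eps -> exists2 delta : R, 0 < delta &
     forall phi, Xsm delta phi -> forall t, 0 <= t -> enorm (phi t) < eps) /\
  (forall rho : R, 0 < rho -> forall phi, Xsm rho phi ->
     phi t @[t --> +oo] --> (0 : 'rV[R]_n)).

End Coefficients.
End Sliding.
End ControlLyapunov.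

(* Main.v *)
(* Near each point of a closed piece, V restricted to that piece has a first
   order expansion with the limit gradient: a C^1 chart straightens the boundary,
   which is a manifold, and the mean value theorem applies along the preimage of
   a segment ending at the point.  Hence V is locally Lipschitz, and for almost
   every t the curve V (phi t) has derivative <grad V_j (phi t), phi' t> for
   every j with phi t in the closed piece j: the values for j and k agree unless
   t is isolated among the times spent in both pieces, and such t form a null set.
   For one such j the derivative is at most - W (phi t): without sliding the
   velocity is f_i for some i whose region D_i accumulates at phi t within the
   piece, and when sliding it is a convex combination of such f_i and of the f_q
   covered by the hypothesis.  Therefore V decreases along every Filippov
   solution at rate W, and Lyapunov's argument concludes. *)
Require Import Defs.
From HB Require Import structures.
From mathcomp Require Import all_boot all_order all_algebra.
From mathcomp Require Import all_classical all_reals all_analysis.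
From mathcomp Require Import ring lra.
Import Order.TTheory GRing.Theory Num.Theory.
Import numFieldNormedType.Exports.
Local Open Scope classical_set_scope.
Local Open Scope ring_scope.
Set Implicit Arguments.
Unset Strict Implicit.
Unset Printing Implicit Defensive.

(** * Continuous induction and null sets on the real line *)

Section RealLine.
Context {R : realType}.
Notation mu := (@lebesgue_measure R).

(* Continuous induction; it plays the role of Cousin's lemma on tagged partitions. *)
Lemma interval_chain (a b : R) (P : R -> Prop) (step : R -> R -> Prop) :
  a <= b -> P a ->
  (forall s t, a <= s -> s <= t -> t <= b -> P s -> step s t -> P t) ->
  (forall t, a <= t <= b -> exists2 d, 0 < d & forall s, a <= s <= b ->
     `|s - t| < d -> (s <= t -> step s t) /\ (t <= s -> step t s)) ->
  P b.
Proof.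
move=> ab Pa PS loc.
pose E := [set t | a <= t <= b /\ P t].
have Ea : E a by split => //; rewrite lexx ab.
have hE : has_sup E by split; [exists a | exists b => t [/andP[]]].
set c := sup E.
have ac : a <= c by apply: ub_le_sup => //; exact: hE.2.
have cb : c <= b by apply: ge_sup; [exists a | move=> t [/andP[]]].
have [|d d0 dc] := loc c; first by rewrite ac.
have [s [/andP[sa sb] Ps] cs] := sup_adherent d0 hE.
have sc : s <= c by apply: ub_le_sup; [exact: hE.2 | rewrite /E /= sa sb].
have Pc : P c.
  apply: (PS s) => //; have [] := dc s; rewrite ?sa ?sb //.
  - by rewrite ler0_norm ?subr_le0 // opprB ltrBlDr -ltrBlDl.
  - by move=> h _; apply: h.
move: cb; rewrite le_eqVlt => /predU1P[<- //|cb].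
(* If [c < b], the step from [c] to this [t] puts a point beyond the supremum into [E]. *)
pose t := Num.min b (c + d / 2).
have ct : c < t by rewrite lt_min cb ltrDl divr_gt0.
have tb : t <= b by rewrite ge_min lexx.
have at_ : a <= t by rewrite (le_trans ac (ltW ct)).
have /(ub_le_sup hE.2) : E t; last by rewrite leNgt ct.
rewrite /E /= at_ tb; split => //; apply: (PS c) => //; first exact: ltW.
have [] := dc t; rewrite ?at_ ?tb //.
- rewrite gtr0_norm ?subr_gt0 // ltrBlDl gt_min.
  by rewrite ltrD2l ltr_pdivrMr // ltr_pMr // ltr1n orbT.
- by move=> _; apply; exact: ltW.
Qed.

(** Meant for exceptional sets given by a local condition, such as isolated points; [A] may be
    nonmeasurable. *)
Lemma locally_negligible (A : set R) :
  (forall t, A t -> exists2 e : R, 0 < e &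
     mu.-negligible (A `&` [set s | `|s - t| < e])) ->
  mu.-negligible A.
Proof.
move=> loc.
pose I (pq : rat * rat) := A `&` [set s | ratr pq.1 < s < ratr pq.2].
(* Codes of no pair, and pairs whose trace on [A] is not negligible, get [set0], so that every [F k]
   is negligible. *)
pose F k := if unpickle k is Some pq then
  if `[< mu.-negligible (I pq) >] then I pq else set0 else set0.
(* Rational intervals: a countable cover, as in Lindelof's theorem. *)
have sub : A `<=` \bigcup_k F k.
  move=> t At; have [e e0 ne] := loc t At.
  have te : t - e < t by rewrite ltrBlDr ltrDl.
  have et : t < t + e by rewrite ltrDl.
  have [p /[!in_itv]/= /andP[p1 p2]] := rat_in_itvoo te.
  have [q /[!in_itv]/= /andP[q1 q2]] := rat_in_itvoo et.
  have ni : mu.-negligible (I (p, q)).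
    apply: negligibleS ne => s [As /= /andP[ps sq]]; split => //=.
    by rewrite ltr_norml; apply/andP; split; lra.
  exists (pickle (p, q)); [exact: Logic.I|rewrite /F pickleK asboolT //].
  by split => //=; rewrite p2 q1.
apply: (@negligibleS _ _ _ mu _ _ sub).
apply: negligible_bigcup => k; rewrite /F.
case: (unpickle k) => [pq|]; last exact: negligible_set0.
by case: asboolP => // _; exact: negligible_set0.
Qed.

End RealLine.

(** * The scalar product, the Euclidean norm and the sup norm *)

Section EuclideanNorm.
Context {R : realType} {n : nat}.
Implicit Types (x y z : 'rV[R]_n).

Lemma dotv_ge0 x : 0 <= dotv x x.
Proof. by apply: sumr_ge0 => i _; rewrite -expr2 sqr_ge0. Qed.

Lemma enorm_ge0 x : 0 <= enorm x. Proof. exact: sqrtr_ge0. Qed.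

Lemma enormN x : enorm (- x) = enorm x.
Proof. by rewrite /enorm /dotv; under eq_bigr do rewrite !mxE mulrNN. Qed.

Lemma enorm_distC x y : enorm (x - y) = enorm (y - x).
Proof. by rewrite -enormN opprB. Qed.

Lemma enorm0 : enorm (0 : 'rV[R]_n) = 0.
Proof. by rewrite /enorm /dotv big1 ?sqrtr0 // => i _; rewrite mxE mul0r. Qed.

Lemma coord_le_norm x i : `|x 0 i| <= `|x|.
Proof. by rewrite [leRHS]/Num.Def.normr /= mx_normrE; exact: (le_bigmax _ _ (0, i)). Qed.

Lemma norm_le_bound x (e : R) : 0 <= e -> (forall i, `|x 0 i| <= e) -> `|x| <= e.
Proof.
move=> e0 xe; rewrite [leLHS]/Num.Def.normr /= mx_normrE; apply/bigmax_leP; split => //.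
by move=> [i j] _ /=; rewrite ord1.
Qed.

Lemma norm_le_enorm x : `|x| <= enorm x.
Proof.
apply: norm_le_bound => [|i]; first exact: enorm_ge0.
rewrite -sqrtr_sqr ler_sqrt ?dotv_ge0 // expr2 /dotv (bigD1 i) //= lerDl.
by apply: sumr_ge0 => k _; rewrite -expr2 sqr_ge0.
Qed.

Lemma dotvBl x y z : dotv (x - y) z = dotv x z - dotv y z.
Proof.
by rewrite /dotv -sumrB; apply: eq_bigr => i _; rewrite !mxE mulrBl.
Qed.

Lemma dotvBr x y z : dotv x (y - z) = dotv x y - dotv x z.
Proof.
by rewrite /dotv -sumrB; apply: eq_bigr => i _; rewrite !mxE mulrBr.
Qed.

Lemma dotvZr (a : R) x y : dotv x (a *: y) = a * dotv x y.
Proof.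
by rewrite /dotv mulr_sumr; apply: eq_bigr => i _; rewrite !mxE mulrCA.
Qed.

Lemma dotv_sumr (I : Type) (r : seq I) (P : pred I) (F : I -> 'rV[R]_n) x :
  dotv x (\sum_(i <- r | P i) F i) = \sum_(i <- r | P i) dotv x (F i).
Proof.
rewrite /dotv exchange_big; apply: eq_bigr => k _ /=.
by rewrite summxE mulr_sumr.
Qed.

(** A Cauchy-Schwarz bound for the sup norm, at the cost of the factor [n]; hence the [n%:R] in
    later constants. *)
Lemma dotv_le_norm x y : `|dotv x y| <= n%:R * `|x| * `|y|.
Proof.
apply: le_trans (ler_norm_sum _ _ _) _.
apply: (@le_trans _ _ (\sum_(i < n) `|x| * `|y|)).
  by apply: ler_sum => i _; rewrite normrM ler_pM ?coord_le_norm.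
by rewrite sumr_const card_ord -mulrA mulr_natl.
Qed.

End EuclideanNorm.

(** * Absolutely continuous curves and monotonicity along them *)

Section AbsolutelyContinuous.
Context {R : realType} {n : nat}.
Notation mu := (@lebesgue_measure R).

Lemma abs_continuous_sub (a b a' b' : R) (phi : R -> 'rV[R]_n) :
  a <= a' -> b' <= b -> abs_continuous a b phi -> abs_continuous a' b' phi.
Proof.
move=> aa bb ac e e0; have [d d0 hd] := ac e e0; exists d => // N s t st.
by apply: hd => k; have [h1 h2 h3] := st k; split=> //; lra.
Qed.

(** Lists replace indexed families so that an induction can add one interval at a time; they run
    from right to left, the newest interval at the head. *)
Lemma abs_continuous_seq (a b e : R) (phi : R -> 'rV[R]_n) :
  abs_continuous a b phi -> 0 < e -> exists2 d, 0 < d &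
  forall l : seq (R * R), all (fun p => [&& a <= p.1, p.1 <= p.2 & p.2 <= b]) l ->
    pairwise (fun p q => q.2 <= p.1) l ->
    \sum_(p <- l) (p.2 - p.1) < d ->
    \sum_(p <- l) enorm (phi p.2 - phi p.1) < e.
Proof.
move=> ac e0; have [d d0 hd] := ac e e0; exists d => // l al pl.
rewrite !(big_nth (0, 0)) !big_mkord.
apply: (hd _ (fun i : 'I_(size l) => (nth (0, 0) l i).1)
   (fun i : 'I_(size l) => (nth (0, 0) l i).2)) => [k|i j ij].
  by have /and3P[] := all_nthP (0, 0) al k (ltn_ord k).
have /(pairwiseP (0, 0)) hp := pl.
have : (i != j :> nat) by []; rewrite neq_ltn => /orP[lt|lt].
  by right; apply: (hp i j) => //; rewrite inE.
by left; apply: (hp j i) => //; rewrite inE.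
Qed.

Lemma abs_continuous_cvg (a b t : R) (phi : R -> 'rV[R]_n) (A : set 'rV[R]_n) :
  abs_continuous a b phi -> a <= t <= b -> nbhs (phi t) A ->
  exists2 d, 0 < d & forall s, a <= s <= b -> `|s - t| < d -> A (phi s).
Proof.
move=> ac /andP[at_ tb] /nbhs_normP[e /= e0 eA].
have [d d0 hd] := abs_continuous_seq ac e0; exists d => // s /andP[as_ sb] st.
apply: eA => /=; apply: le_lt_trans (norm_le_enorm _) _.
have [le|le] := leP s t.
  have := hd [:: (s, t)]; rewrite !big_seq1 /= as_ tb le; apply => //.
  by move: st; rewrite ltr_norml; lra.
have := hd [:: (t, s)]; rewrite !big_seq1 /= at_ sb (ltW le) enorm_distC.
by apply => //; move: st; rewrite ltr_norml; lra.
Qed.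

(** Off [N] only upper bounds on difference quotients of [g] are assumed, no derivative. On [N] the
    increments of [g] are dominated by those of [phi], whose sum over intervals of small total
    length is small. *)
Lemma abs_continuous_decrease (a b L c : R) (g : R -> R) (phi : R -> 'rV[R]_n)
    (N : set R) :
  a <= b -> 0 <= L -> abs_continuous a b phi -> mu.-negligible N ->
  (forall t, a <= t <= b -> exists2 d, 0 < d & forall s, a <= s <= b ->
     `|s - t| < d -> `|g s - g t| <= L * enorm (phi s - phi t)) ->
  (forall t e, a <= t <= b -> ~ N t -> 0 < e -> exists2 d, 0 < d &
     forall s, a <= s <= b -> `|s - t| < d ->
     (s <= t -> g t - g s <= (- c + e) * (t - s)) /\
     (t <= s -> g s - g t <= (- c + e) * (s - t))) ->
  g b <= g a - c * (b - a).
Proof.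
move=> ab L0 ac [A [mA A0 NA]] bad good; apply/ler_addgt0Pr => e' e'0.
(* Three errors of size [e] arise, weighted by [b - a] (slopes), [L] (increments of [phi]) and the
   absolute value of [c] (length of the steps inside [U]); [1] keeps [K] positive. *)
pose K := b - a + L + `|c| + 1.
have K0 : 0 < K by rewrite /K; have := normr_ge0 c; lra.
pose e := e' / K; have e0 : 0 < e by rewrite divr_gt0.
have [d d0 hd] := abs_continuous_seq ac e0.
have de0 : 0 < Num.min d e by rewrite lt_min d0 e0.
have Afin : (mu A < +oo)%E by rewrite A0 ltry.
have [U [oU AU muO]] := lebesgue_regularity_outer mA Afin de0.
have mU : measurable U by exact: measurable_realfun.open_measurable.
have UI t : measurable (U `&` `]-oo, t]) by apply: measurableI.
(* Outer regularity bounds the measure of [U] minus [A]; adding the null set [A] back costs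
   nothing. *)
have muOt t : (mu (U `&` `]-oo, t]) < (Num.min d e)%:E)%E.
  apply: le_lt_trans muO; rewrite -[leRHS]adde0 -A0 -measureU //; last first.
  - by rewrite setDE -setIA setICl setI0.
  - exact: measurableD.
  apply: le_measure; rewrite ?inE; [exact: UI | by apply: measurableU => //; apply: measurableD |].
  by move=> x [Ux _]; have [xA|xA] := pselect (A x); [right|left].
(* [b] is reached from [a] by finitely many steps, either with the expected
   slope or inside an open set [U] of small measure containing [N]; absolute
   continuity bounds the total increment of [phi] over the latter. *)
pose step s t := g t - g s <= (- c + e) * (t - s) \/
  `[s, t] `<=` U /\ g t - g s <= L * enorm (phi t - phi s).
pose P t := exists l : seq (R * R),
  [/\ all (fun p => [&& a <= p.1, p.1 <= p.2 & p.2 <= t]) l,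
      pairwise (fun p q => q.2 <= p.1) l,
      ((\sum_(p <- l) (p.2 - p.1))%:E <= mu (U `&` `]-oo, t]))%E
    & g t - g a <= (- c + e) * (t - a)
        + L * (\sum_(p <- l) enorm (phi p.2 - phi p.1))
        + `|c| * (\sum_(p <- l) (p.2 - p.1))].
have : P b.
  apply: (@interval_chain R a b P step) => //.
  - by exists [::]; split=> //; rewrite !big_nil ?measure_ge0 // !subrr !mulr0 !addr0.
  - move=> s t as_ st tb [l [al pl sl gl]] hst.
    have alt : all (fun p => [&& a <= p.1, p.1 <= p.2 & p.2 <= t]) l.
      by apply: sub_all al => p /and3P[-> -> h] /=; exact: le_trans h st.
    case: hst => [hst|[hU hst]].
      exists l; split => //; last by lra.
      apply: le_trans sl _; apply: le_measure; rewrite ?inE; [exact: UI|exact: UI|].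
      by move=> x [Ux /=]; rewrite in_itv /= => xs; split => //=; rewrite in_itv /=; lra.
    exists ((s, t) :: l); split.
    + by rewrite /= as_ st lexx.
    + rewrite /= pl andbT; apply: sub_all al => p /and3P[_ _ h] //.
    (* The new step counts as []s, t]], disjoint from the part of [U] up to [s], so the measures
       add. *)
    + rewrite big_cons EFinD addeC /=.
      have -> : (t - s)%:E = mu `]s, t].
        rewrite lebesgue_measure_itv /= lte_fin; case: ltP => [//|ts].
        have -> : t = s by apply/eqP; rewrite eq_le ts st.
        by rewrite subrr.
      apply: le_trans (leeD2r _ sl) _; rewrite -measureU; [|exact: UI|exact: measurable_itv|].
        apply: le_measure; rewrite ?inE; [by apply: measurableU; [exact: UI|exact: measurable_itv]|exact: UI|].
        move=> x [[Ux /=]|/=]; rewrite !in_itv /= => xs; split => //=; rewrite ?in_itv /=.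
        * by lra.
        * by apply: hU; rewrite /= in_itv /=; lra.
        * by lra.
      by apply/seteqP; split => // x [[_ /=]]; rewrite !in_itv /=; lra.
    (* On a step inside [U] the term [- c * (t - s)] may be negative; the last summand of [P]
       compensates for it. *)
    + rewrite !big_cons /= !mulrDr.
      have : - c * (t - s) + `|c| * (t - s) >= 0.
        rewrite -mulrDl mulr_ge0 ?subr_ge0 //.
        by rewrite addrC subr_ge0 ler_norm.
      have : 0 <= e * (t - s) by rewrite mulr_ge0 ?subr_ge0 // ltW.
      lra.
  - move=> t tab; have [Nt|Nt] := pselect (N t); last first.
      have [d' d'0 h] := good t e tab Nt e0; exists d' => // s sab st.
      by have [h1 h2] := h s sab st; split => st'; left; auto.
    have [d1 d10 h1] := bad t tab.
    have /nbhs_normP[d2 /= d20 h2] : nbhs t U.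
      by apply: open_nbhs_nbhs; split => //; apply: AU; apply: NA.
    exists (Num.min d1 d2); first by rewrite lt_min d10 d20.
    move=> s sab; rewrite lt_min => /andP[st1 st2]; have := h1 s sab st1.
    move: st2; rewrite ltr_norml => /andP[lo hi] h3; split => st; right; split.
    + move=> x /=; rewrite in_itv /= => /andP[x1 x2]; apply: h2 => /=.
      by rewrite ltr_norml; lra.
    + by rewrite enorm_distC; apply: le_trans h3; rewrite distrC ler_norm.
    + move=> x /=; rewrite in_itv /= => /andP[x1 x2]; apply: h2 => /=.
      by rewrite ltr_norml; lra.
    + by apply: le_trans h3; rewrite ler_norm.
move=> [l [al pl sl gl]].
have : \sum_(p <- l) (p.2 - p.1) < Num.min d e.
  by rewrite -lte_fin; apply: le_lt_trans sl _.
rewrite lt_min => /andP[s1 s2].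
have s3 := hd l al pl s1.
have eK : e * K = e' by rewrite divfK ?gt_eqF.
have {eK} := eK; rewrite {1}/K.
have := ler_wpM2l L0 (ltW s3); have := ler_wpM2l (normr_ge0 c) (ltW s2); lra.
Qed.

End AbsolutelyContinuous.

(** * Differentials and their local bounds *)

Section Differentials.
Context {R : realType}.

Lemma diff_expansion (V W : normedModType R) (f : V -> W) x (e : R) :
  differentiable f x -> 0 < e ->
  \forall q \near x, `|f q - f x - 'd f x (q - x)| <= e * `|q - x|.
Proof.
move=> /diff_locally /eqaddoP h e0; have /nbhs_normP[d /= d0 hd] := h e e0.
apply/nbhs_normP; exists d => //= q qx.
have -> : f q - f x - 'd f x (q - x) = (f \o +%R^~ x - (cst (f x) + 'd f x)) (q - x).
  by rewrite !fctE /= subrK opprD addrA.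
by apply: hd => /=; rewrite sub0r normrN distrC.
Qed.

Lemma linear_rV_bound n (W : normedModType R) (g : {linear 'rV[R]_n -> W}) v :
  `|g v| <= `|v| * \sum_(i < n) `|g 'e_i|.
Proof.
rewrite {1}(row_sum_delta v) linear_sum mulr_sumr.
apply: le_trans (ler_norm_sum _ _ _) _; apply: ler_sum => i _.
by rewrite linearZ normrZ ler_wpM2r // coord_le_norm.
Qed.

Lemma diff_pointwise_lipschitz n (W : normedModType R) (f : 'rV[R]_n -> W) x :
  differentiable f x ->
  exists2 C : R, 0 <= C & \forall q \near x, `|f q - f x| <= C * `|q - x|.
Proof.
move=> df; exists (\sum_(i < n) `|'d f x 'e_i| + 1).
  by rewrite addr_ge0 // sumr_ge0.
have := diff_expansion df ltr01; apply: filterS => q; rewrite mul1r => h.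
rewrite -(subrK ('d f x (q - x)) (f q - f x)) mulrDl mul1r addrC.
by apply: le_trans (ler_normD _ _) _; rewrite lerD // mulrC linear_rV_bound.
Qed.

(** A linear map is bounded through its values on the basis, and these finitely many partial
    derivatives stay near their values at [x]. One [C] then serves along a whole segment near
    [x]. *)
Lemma C1_diff_bound n (W : normedModType R) (U : set 'rV[R]_n)
    (f : 'rV[R]_n -> W) x :
  open U -> U x -> C1_on U f ->
  exists2 C : R, 0 <= C &
    \forall y \near x, forall w, `|'d f y w| <= C * `|w|.
Proof.
move=> oU Ux C1; exists (\sum_(i < n) (`|'D_('e_i) f x| + 1)).
  by apply: sumr_ge0 => i _; rewrite addr_ge0.
have hi (i : 'I_n) : \forall y \near x, `|'D_('e_i) f y| <= `|'D_('e_i) f x| + 1.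
  have /cvgrPdist_le/(_ _ ltr01) := (C1 x Ux).2 'e_i.
  apply: filterS => y xy; rewrite -lerBlDl; apply: le_trans (lerB_dist _ _) _.
  by rewrite distrC.
have h := filter_forall (nbhs_filter x) hi.
have Uy : \forall y \near x, U y by exact: open_nbhs_nbhs.
apply: filterS2 h Uy => y hy Uy w.
rewrite mulrC; apply: le_trans (linear_rV_bound _ _) _; rewrite ler_wpM2l //.
by apply: ler_sum => i _; rewrite -deriveE //; exact: (C1 y Uy).1.
Qed.

Lemma dotv_is_linear n (u : 'rV[R]_n) : linear (dotv u).
Proof.
move=> a x y; rewrite /dotv scaler_sumr -big_split; apply: eq_bigr => i _ /=.
by rewrite !mxE mulrDr mulrCA.
Qed.

End Differentials.

HB.instance Definition _ (R : realType) n (u : 'rV[R]_n) :=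
  GRing.isLinear.Build R 'rV[R]_n R *:%R (dotv u) (dotv_is_linear u).

(** * Gradients as linear forms, and paths that avoid a boundary *)

Section PieceExpansion.
Context {R : realType} {n : nat}.
Implicit Types (x p q : 'rV[R]_n) (V : 'rV[R]_n -> R).

Lemma dotv_continuous (u : 'rV[R]_n) : continuous (dotv u).
Proof.
move=> x; apply/(@cvgrPdist_le _ _ _ _ (nbhs_filter x)) => e e0.
pose K := n%:R * `|u| + 1; have K0 : 0 < K by rewrite ltr_wpDl // mulr_ge0.
suff : \forall y \near x, `|dotv u x - dotv u y| <= e by [].
apply/nbhs_normP; exists (e / K) => /= [|y xy]; first by rewrite divr_gt0.
rewrite -dotvBr; apply: le_trans (dotv_le_norm _ _) _.
rewrite -(divfK (lt0r_neq0 K0) e) mulrC [leRHS]mulrC.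
by rewrite [leLHS]mulrC ler_pM ?mulr_ge0 ?(ltW xy) // lerDl.
Qed.

Lemma dotv_differentiable (u : 'rV[R]_n) x : differentiable (dotv u) x.
Proof. exact: linear_differentiable (@dotv_continuous u). Qed.

Lemma diff_dotv (u : 'rV[R]_n) x : 'd (dotv u) x = dotv u :> (_ -> _).
Proof.
exact: diff_lin (@dotv_continuous u).
Qed.

Lemma diff_gradE V x w : differentiable V x -> 'd V x w = dotv (grad V x) w.
Proof.
move=> dV; rewrite {1}(row_sum_delta w) linear_sum /dotv; apply: eq_bigr => i _.
by rewrite linearZ /grad mxE deriveE // [LHS]mulrC.
Qed.

Lemma bd_open (Om : set 'rV[R]_n) x : open Om ->
  bd Om x <-> closure Om x /\ ~ Om x.
Proof. by move=> /interior_id oOm; rewrite /bd oOm. Qed.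

(** [Om] and the complement of its closure are separated, and the image of an interval is
    connected. *)
Lemma path_avoiding_bd (Om : set 'rV[R]_n) (c : R -> 'rV[R]_n) (b : R) :
  open Om -> {in `[0, b], continuous c} -> Om (c 0) ->
  (forall s, 0 <= s <= b -> ~ bd Om (c s)) ->
  forall s, 0 <= s <= b -> Om (c s).
Proof.
move=> oOm cc c0 cbd s s0b.
have sep : separated Om (~` closure Om).
  split; first exact: setICr.
  by rewrite closure_setC; apply/seteqP; split => // x [Ox]; apply; apply: filterS (@subset_closure _ Om) _; exact: open_nbhs_nbhs.
have conn : connected (c @` `[0, b]).
  apply: connected_continuous_connected; first exact: segment_connected.
  by apply: continuous_in_subspaceT => t; rewrite inE; exact: cc.
have sub : c @` `[0, b] `<=` Om `|` ~` closure Om.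
  move=> _ [t /= t0b <-]; have [Ot|Ot] := pselect (Om (c t)); [by left|right].
  by move=> cl; apply: (cbd t); [move: t0b; rewrite in_itv | apply/bd_open].
have [h|h] := connected_subset sep sub conn.
  by apply: h; exists s.
have [] : (~` closure Om) (c 0).
  by apply: h; exists 0 => //=; rewrite in_itv /= lexx; case/andP: s0b; exact: le_trans.
exact: subset_closure.
Qed.

End PieceExpansion.

(** * First order expansion of [V] at a boundary point of a piece *)

Section BoundaryExpansion.
Context {R : realType} {n : nat}.

Lemma line_derive (W : normedModType R) (a w : W) (s : R) :
  differentiable (fun t : R => a + t *: w) s /\
  'd (fun t : R => a + t *: w) s 1 = w.
Proof.
pose l : R -> W := *:%R^~ w.
have dl : is_diff s l l by exact: is_diff_scalel.
have ddl : differentiable l s by exact: ex_diff.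
have -> : (fun t : R => a + t *: w) = cst a + l by apply/funext => t; rewrite !fctE.
have da : differentiable (cst a : R -> W) s by exact: differentiable_cst.
split; first by apply: differentiableD => //.
rewrite (diffD da ddl).
have dle : 'd l s = l :> (_ -> _) := diff_val.
by rewrite diff_cst [LHS]add0r dle /l scale1r.
Qed.

(** The function is nonnegative exactly where a first order expansion holds up to [e]; its
    continuity carries such an expansion to a closure. *)
Lemma remainder_gap_continuous (W : normedModType R) (g l : W -> R) (p : W) (e : R) :
  continuous g -> continuous l ->
  continuous (fun q => e * `|q - p| - `|g q - g p - l (q - p)|).
Proof.
move=> gc lc x.
have cx : q - p @[q --> x] --> x - p.
  by apply: cvgB; [exact: cvg_id|exact: cvg_cst].
have cl : l (q - p) @[q --> x] --> l (x - p) by exact: cvg_comp cx (lc (x - p)).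
have cg : g q - g p - l (q - p) @[q --> x] --> g x - g p - l (x - p).
  by apply: cvgB cl; apply: cvgB; [exact: gc|exact: cvg_cst].
apply: cvgB (cvg_norm cg).
by apply: cvgM (cvg_norm cx); exact: cvg_cst.
Qed.

Implicit Types (x p q : 'rV[R]_n) (V : 'rV[R]_n -> R).

Lemma near_closure (Om : set 'rV[R]_n) (h : 'rV[R]_n -> R) p :
  continuous h -> (\forall q \near p, Om q -> 0 <= h q) ->
  \forall q \near p, closure Om q -> 0 <= h q.
Proof.
move=> hc /nbhs_normP[r /= r0 hr]; apply/nbhs_normP; exists r => //= q qp clq.
rewrite leNgt; apply/negP => hq.
have n1 : \forall z \near q, h z < 0.
  exact: (cvgr_lt (h q) (hc q) 0 hq).
have n2 : \forall z \near q, ball_ Num.Def.normr p r z.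
  apply/nbhs_normP; exists (r - `|p - q|); first by rewrite /= subr_gt0.
  move=> z /= qz; rewrite -[p](subrK q) -addrA.
  by apply: le_lt_trans (ler_normD _ _) _; rewrite -ltrBrDl.
have [z [Oz [z1 z2]]] := clq _ (filterI n1 n2).
by have := hr z z2 Oz; rewrite leNgt z1.
Qed.

(** The segment from [q] to [p] may leave [Om]; it is replaced by a curve that is straight in a
    chart. The mean value theorem for [V - dotv G] along this curve gives a remainder governed by
    [grad V - G], which is small near [p] inside [Om]. *)
Lemma boundary_expansion_open V (Om : set 'rV[R]_n) p G (e : R) :
  continuous V -> open Om -> C1_on Om V -> submanifold (bd Om) -> bd Om p ->
  grad V z @[z --> within Om (nbhs p)] --> G -> 0 < e ->
  \forall q \near p, Om q -> `|V q - V p - dotv G (q - p)| <= e * `|q - p|.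
Proof.
move=> Vc oOm VC1 [d dn /(_ p)] man bdp gradG e0.
have [U [phi [psi [[oU Up] phiC1 [oU' psiC1] psiK bdE]]]] := man bdp.
set y0 := phi p; set U' := phi @` U.
have U'y0 : U' y0 by exists p.
have [C C0 hC] := C1_diff_bound oU' U'y0 psiC1.
have dphi : differentiable phi p := (phiC1 p Up).1.
have [C' C'0 hC'] := diff_pointwise_lipschitz dphi.
(* The final estimate is [n * e' * C * C'] times the distance from [q] to [p]: [C] bounds the
   differential of [psi], [C'] the growth of [phi], and [n] comes from [dotv_le_norm]. *)
pose e' := e / (n%:R * (C * C') + 1).
have K0 : 0 < n%:R * (C * C') + 1 by rewrite ltr_wpDl // !mulr_ge0.
have e'0 : 0 < e' by rewrite divr_gt0.
have hg : \forall z \near p, Om z -> `|G - grad V z| <= e'.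
  by have /cvgrPdist_le/(_ _ e'0) := gradG.
have dpsi : differentiable psi y0 := (psiC1 y0 U'y0).1.
have hpsi : \forall y \near y0, Om (psi y) -> `|G - grad V (psi y)| <= e'.
  have hg' : nbhs (psi y0) [set z | Om z -> `|G - grad V z| <= e'] by rewrite psiK.
  exact: (differentiable_continuous dpsi hg').
have hU' : \forall y \near y0, U' y by exact: open_nbhs_nbhs.
have hB3 : \forall y \near y0, [/\ forall v, `|'d psi y v| <= C * `|v|,
    Om (psi y) -> `|G - grad V (psi y)| <= e' & U' y].
  by apply: filterS3 hC hpsi hU' => y h1 h2 h3; split.
(* A ball is convex, so the bounds hold all along the segment from [phi q] to [y0]. *)
have /nbhs_normP[rho /= rho0 hB] := hB3.
have n1 : \forall q \near p, `|y0 - phi q| < rho.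
  have /cvgrPdist_lt := differentiable_continuous dphi; exact.
have n2 : \forall q \near p, U q by exact: open_nbhs_nbhs.
apply: filterS3 n1 n2 hC' => q q1 Uq q2 Oq.
(* In the chart, the segment from [phi q] to [y0] meets the boundary only at
   [y0]: a coordinate that vanishes on the boundary but not at [phi q] vanishes
   on the segment only at its end point. *)
set w := y0 - phi q in q1.
pose y (s : R) := phi q + s *: w.
pose c := psi \o y.
have yB (s : R) : 0 <= s <= 1 -> `|y0 - y s| < rho.
  move=> /andP[s0 s1]; have -> : y0 - y s = (1 - s) *: w.
    by rewrite /y opprD addrA scalerBl scale1r.
  rewrite normrZ; apply: le_lt_trans q1; rewrite ger0_norm ?subr_ge0 //.
  by rewrite ler_piMl // lerBlDr lerDl.
have dy (s : R) : differentiable y s by have [] := line_derive (phi q) w s.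
have dpsiy (s : R) : 0 <= s <= 1 -> differentiable psi (y s).
  by move=> /yB /hB [_ _] /psiC1 [].
have dc (s : R) : 0 <= s <= 1 -> differentiable c s.
  by move=> s01; apply: differentiable_comp => //; exact: dpsiy.
have cc (s : R) : 0 <= s <= 1 -> {for s, continuous c}.
  by move=> s01; apply: differentiable_continuous; exact: dc.
have c0 : c 0 = q by rewrite /c /= /y scale0r addr0 psiK.
have c1 : c 1 = p by rewrite /c /= /y scale1r /w addrC subrK psiK.
have bdp0 : forall i : 'I_n, (d <= i)%N -> y0 0 i = 0 by apply/(bdE p Up).
have cbd (s : R) : 0 <= s < 1 -> ~ bd Om (c s).
  move=> /andP[s0 s1]; have s01 : 0 <= s <= 1 by rewrite s0 ltW.
  have [_ _ [z Uz yz]] := hB _ (yB s s01).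
  rewrite /c /= -yz psiK // => /(bdE z Uz) bz.
  have [_] : closure Om q /\ ~ Om q; last by [].
  apply/(bd_open _ oOm)/(bdE q Uq) => i di; have := bz i di.
  rewrite yz /y /w !mxE bdp0 // sub0r mulrN -[X in X - _]mul1r -mulrBl.
  by move/eqP; rewrite mulf_eq0 subr_eq0 (gt_eqF s1) => /eqP.
have cOm (s : R) : 0 <= s < 1 -> Om (c s).
  move=> /andP[s0 s1]; apply: (@path_avoiding_bd _ _ _ c s) => //.
  - move=> t; rewrite in_itv /= => /andP[t0 ts]; apply: cc.
    by rewrite t0 (le_trans ts) // ltW.
  - by rewrite c0.
  - by move=> t /andP[t0 ts]; apply: cbd; rewrite t0 (le_lt_trans ts).
  - by rewrite s0 lexx.
(* The increment of [u] from 0 to 1 is the remainder up to sign. *)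
pose u := (V - dotv G) \o c.
have du (s : R) : 0 <= s < 1 -> differentiable (V - dotv G) (c s).
  by move=> /cOm /VC1 [dV _]; apply: differentiableB => //; exact: dotv_differentiable.
pose df s := dotv (grad V (c s) - G) ('d psi (y s) w).
have u_deriv (s : R) : s \in `]0, 1[ -> is_derive s 1 u (df s).
  rewrite in_itv /= => /andP[s0 s1].
  have s01 : 0 <= s <= 1 by rewrite !ltW.
  have s01' : 0 <= s < 1 by rewrite ltW.
  have dV : differentiable V (c s) := (VC1 _ (cOm s s01')).1.
  have dG := @dotv_differentiable _ _ G (c s).
  have dcs : 'd c s 1 = 'd psi (y s) w.
    rewrite (diff_comp (dy s) (dpsiy s s01)) /=.
    by have [_ ->] := line_derive (phi q) w s.
  apply: DeriveDef.
    by apply: diff_derivable; apply: differentiable_comp; [exact: dc|exact: du].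
  rewrite deriveE; last by apply: differentiable_comp; [exact: dc|exact: du].
  rewrite (diff_comp (dc s s01) (du s s01')) /= dcs (diffB dV dG).
  rewrite /df dotvBl -(diff_gradE _ dV).
  by congr (_ - _); rewrite diff_dotv.
have u_cont : {within `[0, 1], continuous u}.
  apply: continuous_in_subspaceT => s; rewrite inE /= in_itv /= => s01.
  apply: continuous_comp; first exact: cc.
  by apply: continuousB; [exact: Vc|exact: dotv_continuous].
have [s] := MVT ltr01 u_deriv u_cont.
rewrite in_itv /= => /andP[s0 s1] hs.
have s01 : 0 <= s <= 1 by rewrite !ltW.
have s01' : 0 <= s < 1 by rewrite ltW.
have [hw hg'' _] := hB _ (yB s s01).
rewrite subr0 mulr1 /u /= c0 c1 !fctE in hs.
have -> : V q - V p - dotv G (q - p) = - (V p - dotv G p - (V q - dotv G q)).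
  by rewrite dotvBr; ring.
rewrite normrN hs; apply: le_trans (dotv_le_norm _ _) _.
rewrite distrC; have g1 := hg'' (cOm s s01').
rewrite distrC in q2; have w1 := le_trans (hw w) (ler_wpM2l C0 q2).
have nC : 0 <= n%:R * (C * C') :> R by rewrite !mulr_ge0.
apply: (@le_trans _ _ (n%:R * e' * (C * (C' * `|q - p|)))).
  by rewrite ler_pM ?mulr_ge0 // ler_wpM2l.
have -> : n%:R * e' * (C * (C' * `|q - p|)) = (n%:R * (C * C')) * e' * `|q - p|.
  by ring.
rewrite ler_wpM2r // /e' mulrCA ger_pMr // ler_pdivrMr // mul1r lerDl.
by [].
Qed.

(** Both sides of the estimate are continuous in [q], so it extends from [Om] to the closure. *)
Lemma boundary_expansion V (Om : set 'rV[R]_n) p G (e : R) :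
  continuous V -> open Om -> C1_on Om V -> submanifold (bd Om) -> bd Om p ->
  grad V z @[z --> within Om (nbhs p)] --> G -> 0 < e ->
  \forall q \near p, closure Om q ->
    `|V q - V p - dotv G (q - p)| <= e * `|q - p|.
Proof.
move=> Vc oOm VC1 man bdp gradG e0.
have := boundary_expansion_open Vc oOm VC1 man bdp gradG e0.
pose h q := e * `|q - p| - `|V q - V p - dotv G (q - p)|.
move=> H; have /near_closure : \forall q \near p, Om q -> 0 <= h q.
  by apply: filterS H => q + Oq => /(_ Oq); rewrite /h subr_ge0.
have hc : continuous h by apply: remainder_gap_continuous; [|exact: dotv_continuous].
by move=> /(_ hc); apply: filterS => q + cq => /(_ cq); rewrite /h subr_ge0.
Qed.

End BoundaryExpansion.

(** * Continuity of locally Lipschitz maps and of scalar products *)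

Section Limits.
Context {R : realType} {n : nat}.

Lemma locally_lipschitz_continuous (W W' : normedModType R) (f : W -> W') :
  [locally [lipschitz f x | x in setT]] -> continuous f.
Proof.
move=> lip x; have [N [_ hN]] := lip (x, x) (conj Logic.I Logic.I).
pose K := `|N| + 1; have K0 : 0 < K by rewrite ltr_wpDl.
have /hN : N < K by rewrite (le_lt_trans (ler_norm N)) // ltrDl.
rewrite /dominated_by /within /= => -[[A B] /= [Ax Bx] AB].
apply/cvgrPdist_le => e e0.
have xe : \forall y \near x, `|x - y| <= e / K.
  by apply/nbhs_normP; exists (e / K) => /= [|y /ltW]; rewrite ?divr_gt0.
apply: filterS2 Bx xe => y By xy.
apply: le_trans (AB (x, y) _ _) _ => //; first by split => //; exact: nbhs_singleton.
by rewrite -ler_pdivlMl // mulrC.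
Qed.

Lemma cvg_dotv (T : Type) (F : set_system T) (a b : T -> 'rV[R]_n)
    (a0 b0 : 'rV[R]_n) : Filter F ->
  a z @[z --> F] --> a0 -> b z @[z --> F] --> b0 ->
  dotv (a z) (b z) @[z --> F] --> dotv a0 b0.
Proof.
move=> FF ca cb; rewrite /dotv; apply: cvg_big => [|i _]; first exact: add_continuous.
by apply: cvgM; [exact: cvg_comp ca (@coord_continuous _ _ _ 0 i a0)|exact: cvg_comp cb (@coord_continuous _ _ _ 0 i b0)].
Qed.

End Limits.

(** * Limit gradients and Lipschitz bounds across the pieces *)

Section Pieces.
Context {R : realType} {n m : nat}.
Variables (V : 'rV[R]_n -> R) (Omega : 'I_m -> set 'rV[R]_n).
Hypothesis V_smooth : piecewise_smooth V Omega.
Hypothesis V_grad : has_boundary_gradients V Omega.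
Implicit Types (p q x : 'rV[R]_n) (j : 'I_m).

Lemma closure_cover p : exists j, closure (Omega j) p.
Proof.
have [_ _ _ cov _] := V_smooth.
by have : [set: 'rV[R]_n] p by []; rewrite -cov => -[j _]; exists j.
Qed.

Lemma piece_disjoint j k x : Omega j x -> Omega k x -> j = k.
Proof.
have [_ _ dis _ _] := V_smooth => jx kx; apply/eqP; apply: contraT => jk.
by have : (Omega j `&` Omega k) x by []; rewrite dis.
Qed.

Lemma piece_grad_in j x : Omega j x -> piece_grad V Omega j x = grad V x.
Proof. by move=> jx; rewrite /piece_grad asboolT. Qed.

Lemma grad_continuous j x : Omega j x -> {for x, continuous (grad V)}.
Proof.
have [_ _ _ _ /(_ j)[C1 _]] := V_smooth => jx.
apply/(@cvgrPdist_le _ _ _ _ (nbhs_filter x)) => e e0.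
have hi (i : 'I_n) : \forall z \near x, `|'D_('e_i) V x - 'D_('e_i) V z| <= e.
  by have /cvgrPdist_le/(_ _ e0) := (C1 x jx).2 'e_i.
apply: filterS (filter_forall (nbhs_filter x) hi) => z hz.
by apply: norm_le_bound (ltW e0) _ => i; rewrite !mxE.
Qed.

(** Points of the open piece use continuity of the gradient, boundary points the assumed limit; the
    two branches of [piece_grad] thus behave alike under limits. *)
Lemma piece_grad_cvg j x : closure (Omega j) x ->
  grad V z @[z --> within (Omega j) (nbhs x)] --> piece_grad V Omega j x.
Proof.
have [_ oO _ _ _] := V_smooth => clx.
have [jx|jx] := pselect (Omega j x).
  rewrite piece_grad_in // => A hA.
  have hz : \forall z \near x, A (grad V z) := grad_continuous jx hA.
  have hO : \forall z \near x, Omega j z -> A (grad V z) by apply: filterS hz.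
  exact: hO.
have /V_grad : bd (Omega j) x by apply/(bd_open _ (oO j)).
by rewrite /piece_grad asboolF.
Qed.

Lemma piece_expansion j p (e : R) : closure (Omega j) p -> 0 < e ->
  \forall q \near p, closure (Omega j) q ->
    `|V q - V p - dotv (piece_grad V Omega j p) (q - p)| <= e * `|q - p|.
Proof.
have [Vc oO _ _ /(_ j)[C1 man]] := V_smooth => clp e0.
have [jp|jp] := pselect (Omega j p); last first.
  have bdp : bd (Omega j) p by apply/(bd_open _ (oO j)).
  exact: boundary_expansion Vc (oO j) C1 man bdp (piece_grad_cvg clp) e0.
have dV : differentiable V p := (C1 p jp).1.
have := diff_expansion dV e0; apply: filterS => q h _.
by rewrite piece_grad_in // -diff_gradE.
Qed.

(** Upper semicontinuity of the set of pieces at a point: finitely many closed sets that miss [p]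
    also miss a neighbourhood of [p]. *)
Lemma near_closure_pieces p :
  \forall q \near p, forall j, closure (Omega j) q -> closure (Omega j) p.
Proof.
apply: (filter_forall (nbhs_filter p)) => j.
have [clp|clp] := pselect (closure (Omega j) p).
  exact: filterE.
have : \forall q \near p, (~` closure (Omega j)) q.
  by apply: open_nbhs_nbhs; split => //; apply: closed_openC; exact: closed_closure.
by apply: filterS => q nq /nq.
Qed.

(** Near [p] the gradients in an open piece stay close to their limit at [p]; a limit gradient at
    [q] is approximated by such gradients and inherits the bound. *)
Lemma piece_grad_bound p : exists2 L : R, 0 <= L & \forall q \near p,
  forall j, closure (Omega j) q -> `|piece_grad V Omega j q| <= L.
Proof.
pose L := \sum_(j < m) (`|piece_grad V Omega j p| + 1).
have Lj j : `|piece_grad V Omega j p| + 1 <= L.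
  by rewrite /L (bigD1 j) //= lerDl sumr_ge0 // => k _; rewrite addr_ge0.
exists L; first by apply: sumr_ge0 => j _; rewrite addr_ge0.
have hj j : \forall q \near p, closure (Omega j) q -> `|piece_grad V Omega j q| <= L.
  have [clp|clp] := pselect (closure (Omega j) p); last first.
    by apply: filterS (near_closure_pieces p) => q /(_ j) h /h.
  have /nbhs_normP[r /= r0 hr] : \forall z \near p, Omega j z -> `|grad V z| <= L.
    have h1 : \forall z \near p, Omega j z -> `|piece_grad V Omega j p - grad V z| <= 1.
      by have /cvgrPdist_le/(_ _ ltr01) := piece_grad_cvg clp.
    apply: filterS h1 => z h jz; apply: le_trans (Lj j).
    rewrite -lerBlDl; apply: le_trans (lerB_dist _ _) _.
    by rewrite distrC h.
  apply/nbhs_normP; exists r => //= q pq clq.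
  apply/ler_addgt0Pr => e e0.
  have h1 : \forall z \near q, Omega j z -> `|piece_grad V Omega j q - grad V z| <= e.
    by have /cvgrPdist_le/(_ _ e0) := piece_grad_cvg clq.
  have h2 : \forall z \near q, ball_ Num.Def.normr p r z.
    apply/nbhs_normP; exists (r - `|p - q|); first by rewrite /= subr_gt0.
    move=> z /= qz; rewrite -[p](subrK q) -addrA.
    by apply: le_lt_trans (ler_normD _ _) _; rewrite -ltrBrDl.
  have [z [jz [z1 z2]]] := clq _ (filterI h1 h2).
  rewrite -[piece_grad _ _ _ _](subrK (grad V z)).
  apply: le_trans (ler_normD _ _) _; rewrite addrC lerD ?z1 //.
  exact: hr z2 jz.
exact: (filter_forall (nbhs_filter p)) hj.
Qed.

(** A point [z] close to [q] lies in a closed piece that also contains [q], so the expansion at [q]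
    applies. The constant is uniform in [q], while the range allowed for [z] depends on [q]. *)
Lemma piecewise_smooth_lipschitz p : exists2 L : R, 0 <= L &
  \forall q \near p, \forall z \near q, `|V z - V q| <= L * `|z - q|.
Proof.
have [L L0 hL] := piece_grad_bound p.
exists (n%:R * L + 1); first by rewrite addr_ge0 // mulr_ge0.
apply: filterS hL => q hq.
have hj j : \forall z \near q, closure (Omega j) q -> closure (Omega j) z ->
    `|V z - V q| <= (n%:R * L + 1) * `|z - q|.
  have [clq|clq] := pselect (closure (Omega j) q); last exact: filterE.
  apply: filterS (piece_expansion clq ltr01) => z h _ /h.
  rewrite mul1r mulrDl mul1r => {}h.
  rewrite -[V z - V q](subrK (dotv (piece_grad V Omega j q) (z - q))) addrC.
  apply: le_trans (ler_normD _ _) _; rewrite lerD //.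
  by apply: le_trans (dotv_le_norm _ _) _; rewrite ler_wpM2r // ler_wpM2l // hq.
apply: filterS2 (filter_forall (nbhs_filter q) hj) (near_closure_pieces q) => z h1 h2.
have [j jz] := closure_cover z.
by apply: (h1 j) => //; exact: h2.
Qed.

End Pieces.

(** * The rate of change of [V] along a curve *)

Section Curves.
Context {R : realType} {n m : nat}.
Notation mu := (@lebesgue_measure R).
Variables (V : 'rV[R]_n -> R) (Omega : 'I_m -> set 'rV[R]_n).
Hypothesis V_smooth : piecewise_smooth V Omega.
Hypothesis V_grad : has_boundary_gradients V Omega.
Implicit Types (phi : R -> 'rV[R]_n) (j k : 'I_m) (s t : R).

Lemma derive1_expansion phi t (e : R) : derivable phi t 1 -> 0 < e ->
  \forall s \near t, `|phi s - phi t - (s - t) *: derive1 phi t| <= e * `|s - t|.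
Proof.
move=> /derivable1_diffP dphi e0; have := diff_expansion dphi e0.
apply: filterS => s; rewrite derive1E' //.
by rewrite -[X in 'd phi t X]mulr1 linearZ.
Qed.

(** Differentiability of [V \o phi] is not claimed: the expansion for [j] concerns only the times
    [s] at which [phi s] lies in the closed piece [j]. *)
Lemma curve_expansion phi t (e : R) : derivable phi t 1 -> 0 < e ->
  \forall s \near t, forall j, closure (Omega j) (phi s) ->
    closure (Omega j) (phi t) /\
    `|V (phi s) - V (phi t)
      - (s - t) * dotv (piece_grad V Omega j (phi t)) (derive1 phi t)|
      <= e * `|s - t|.
Proof.
move=> dphi e0; set v := derive1 phi t; set x := phi t.
have cphi : {for t, continuous phi}.
  by apply: differentiable_continuous; apply/derivable1_diffP.
have hJ : \forall s \near t, forall j, closure (Omega j) (phi s) -> closure (Omega j) x.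
  exact: (cphi _ (near_closure_pieces Omega x)).
have hj j : \forall s \near t, closure (Omega j) (phi s) ->
    closure (Omega j) x /\ `|V (phi s) - V x -
      (s - t) * dotv (piece_grad V Omega j x) v| <= e * `|s - t|.
  have [clx|clx] := pselect (closure (Omega j) x); last first.
    by apply: filterS hJ => s hs js; case: clx; exact: hs.
  set G := piece_grad V Omega j x.
  (* [K] bounds the difference quotients of [phi] near [t], and [K'] the effect of [G]. One half of
     [e] goes to the expansion of [V], the other to that of [phi]. *)
  pose K := `|v| + 1; have K0 : 0 < K by rewrite ltr_wpDl.
  pose e2 := e / 2 / K; have e20 : 0 < e2 by rewrite !divr_gt0.
  pose K' := n%:R * `|G| + 1; have K'0 : 0 < K' by rewrite ltr_wpDl // mulr_ge0.
  pose e1 := e / 2 / K'; have e10 : 0 < e1 by rewrite !divr_gt0.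
  have e1K : n%:R * `|G| * e1 <= e / 2.
    by rewrite -(divfK (lt0r_neq0 K'0) (e / 2)) mulrC ler_wpM2l ?(ltW e10) // lerDl.
  have e2K : e2 * K = e / 2 by rewrite divfK // gt_eqF.
  have h2 : \forall s \near t, closure (Omega j) (phi s) ->
      `|V (phi s) - V x - dotv G (phi s - x)| <= e2 * `|phi s - x|.
    exact: (cphi _ (piece_expansion V_smooth V_grad clx e20)).
  apply: filterS3 h2 (derive1_expansion dphi e10) (derive1_expansion dphi ltr01).
  move=> s h3 h4; rewrite mul1r -/x -/v => h5 cls; split => //.
  have := h3 cls => {}h3.
  have h6 : `|phi s - x| <= K * `|s - t|.
    rewrite -[phi s - x](subrK ((s - t) *: v)) mulrDl mul1r addrC.
    by apply: le_trans (ler_normD _ _) _; rewrite lerD // normrZ mulrC.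
  have h7 : `|dotv G (phi s - x) - (s - t) * dotv G v| <= e / 2 * `|s - t|.
    rewrite -dotvZr -dotvBr; apply: le_trans (dotv_le_norm _ _) _.
    apply: le_trans (ler_wpM2l _ h4) _; first by rewrite mulr_ge0.
    by rewrite mulrA ler_wpM2r.
  have h8 : `|V (phi s) - V x - dotv G (phi s - x)| <= e / 2 * `|s - t|.
    apply: le_trans h3 _; apply: le_trans (ler_wpM2l (ltW e20) h6) _.
    by rewrite mulrA e2K.
  have -> : V (phi s) - V x - (s - t) * dotv G v =
    (V (phi s) - V x - dotv G (phi s - x)) +
    (dotv G (phi s - x) - (s - t) * dotv G v) by ring.
  by apply: le_trans (ler_normD _ _) _; lra.
exact: (filter_forall (nbhs_filter t)) hj.
Qed.

(** Near an isolated point of [A], the exceptional set is contained in that single point. *)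
Lemma ae_accumulation (A : set R) :
  {ae mu, forall t, A t -> forall d : R, 0 < d ->
    exists s, [/\ s != t, `|s - t| < d & A s]}.
Proof.
apply: locally_negligible => t /= /not_implyP[At] /existsNP[d] /not_implyP[d0 nd].
have nt : mu.-negligible [set t].
  by apply/negligibleP => //; exact: lebesgue_measure_set1.
exists d => //; apply: negligibleS nt => s [/= /not_implyP[As _] st].
by apply: contrapT => /eqP nst; apply: nd; exists s.
Qed.

(* Almost every time spent in the intersection of two closed pieces is an
   accumulation point of such times, along which [V] has both expansions. *)
Lemma ae_pieces_agree phi : {ae mu, forall t, derivable phi t 1 ->
  forall j k, closure (Omega j) (phi t) -> closure (Omega k) (phi t) ->
    dotv (piece_grad V Omega j (phi t)) (derive1 phi t) =
    dotv (piece_grad V Omega k (phi t)) (derive1 phi t)}.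
Proof.
pose T (jk : 'I_m * 'I_m) :=
  [set t | closure (Omega jk.1) (phi t) /\ closure (Omega jk.2) (phi t)].
have := filter_forall (ae_filter_ringOfSetsType mu) (fun jk => ae_accumulation (T jk)).
apply: filterS => t h dphi j k jt kt.
set v := derive1 phi t; set a := dotv _ _; set b := dotv _ _.
apply/eqP; rewrite -subr_eq0 -normr_le0; apply/ler_addgt0Pr => e e0.
have e20 : 0 < e / 2 by rewrite divr_gt0.
have /nbhs_normP[d /= d0 hd] := curve_expansion dphi e20.
have [|s [st std [js ks]]] := h (j, k) _ d d0; first by split.
have /hd hs : `|t - s| < d by rewrite distrC.
have [_ h1] := hs j js; have [_ h2] := hs k ks.
have st0 : 0 < `|s - t| by rewrite normr_gt0 subr_eq0.
rewrite add0r -(ler_pM2r st0) -normrM.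
have -> : (a - b) * (s - t) = (V (phi s) - V (phi t) - (s - t) * b) -
   (V (phi s) - V (phi t) - (s - t) * a) by ring.
by apply: le_trans (ler_normB _ _) _; rewrite -/v -/a -/b in h1 h2; lra.
Qed.

(** Compactness of [[a, b]], in the form of [interval_chain], turns local constants into a single
    one. *)
Lemma curve_lipschitz phi (a b : R) : a <= b -> abs_continuous a b phi ->
  exists2 L : R, 0 <= L & forall t, a <= t <= b ->
    \forall z \near phi t, `|V z - V (phi t)| <= L * `|z - phi t|.
Proof.
move=> ab ac.
pose good (s t : R) := exists2 L : R, 0 <= L & forall r, s <= r <= t ->
    \forall z \near phi r, `|V z - V (phi r)| <= L * `|z - phi r|.
have weaken (L L' : R) (p : 'rV[R]_n) : L <= L' ->
    (\forall z \near p, `|V z - V p| <= L * `|z - p|) ->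
    \forall z \near p, `|V z - V p| <= L' * `|z - p|.
  by move=> LL; apply: filterS => z h; apply: le_trans h _; rewrite ler_wpM2r.
have local r : a <= r <= b -> exists2 d, 0 < d & exists2 L : R, 0 <= L &
    forall s, a <= s <= b -> `|s - r| < d ->
    \forall z \near phi s, `|V z - V (phi s)| <= L * `|z - phi s|.
  move=> rab; have [L L0 hL] := piecewise_smooth_lipschitz V_smooth V_grad (phi r).
  have [d d0 hd] := abs_continuous_cvg ac rab hL.
  by exists d => //; exists L.
apply: (@interval_chain R a b (good a) good) => //.
- have [|d d0 [L L0 h]] := local a; first by rewrite lexx ab.
  exists L => // r ra; have -> : r = a by apply/eqP; rewrite eq_le andbC.
  by apply: h; rewrite ?lexx ?ab // subrr normr0.
- move=> s t as_ st tb [L1 L10 h1] [L2 L20 h2].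
  exists (L1 + L2) => [|r /andP[ar rt]]; first by rewrite addr_ge0.
  have [rs|rs] := leP r s.
    by apply: weaken (h1 r _); [rewrite lerDl|rewrite ar rs].
  by apply: weaken (h2 r _); [rewrite lerDr|rewrite (ltW rs) rt].
- move=> t tab; have [d d0 [L L0 h]] := local t tab; exists d => // s sab.
  rewrite ltr_norml => /andP[st1 st2].
  split => st; exists L => // r /andP[r1 r2]; apply: h;
    rewrite ?ltr_norml; apply/andP; split; move: tab sab => /andP[? ?] /andP[? ?]; lra.
Qed.

Lemma curve_decrease phi (a b c : R) : a <= b -> abs_continuous a b phi ->
  {ae mu, forall t, a < t <= b -> derivable phi t 1 /\
    forall j, closure (Omega j) (phi t) ->
      dotv (piece_grad V Omega j (phi t)) (derive1 phi t) <= - c} ->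
  V (phi b) <= V (phi a) - c * (b - a).
Proof.
move=> ab ac dec; have [L L0 hL] := curve_lipschitz ab ac.
(* The assumption concerns times after [a], so [a] itself joins the exceptional set. *)
have Na : mu.-negligible [set a].
  by apply/negligibleP => //; exact: lebesgue_measure_set1.
apply: (abs_continuous_decrease (g := V \o phi) ab L0 ac (negligibleU dec Na)).
- move=> t tab; have [d d0 hd] := abs_continuous_cvg ac tab (hL t tab).
  exists d => // s sab st; apply: le_trans (hd s sab st) _.
  by rewrite ler_wpM2l // norm_le_enorm.
- move=> t e tab nN e0.
  have ta : a < t.
    rewrite lt_neqAle; case/andP: tab => -> _; rewrite andbT; apply/eqP => ta.
    by apply: nN; right.
  have [dphi hj] : derivable phi t 1 /\ forall j, closure (Omega j) (phi t) ->
      dotv (piece_grad V Omega j (phi t)) (derive1 phi t) <= - c.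
    apply: contrapT => nt; apply: nN; left => /= h; apply: nt; apply: h.
    by rewrite ta; case/andP: tab.
  have /nbhs_normP[d /= d0 hd] := curve_expansion dphi e0.
  exists d => // s sab st.
  (* The piece is chosen at the nearby time [s] and transferred to [t] by the expansion; hence the
     bound is assumed for every piece containing [phi t]. *)
  have [j js] := closure_cover V_smooth (phi s).
  have /hd/(_ j js)[jt] : `|t - s| < d by rewrite distrC.
  have := hj j jt; move: (dotv _ _) => D Dc.
  move=> h; split => ts; move: h; rewrite ler_norml => /andP[h1 h2].
    rewrite ler0_norm ?subr_le0 // in h1 h2.
    have : 0 <= (t - s) * (- c - D) by rewrite mulr_ge0 ?subr_ge0.
    lra.
  rewrite ger0_norm ?subr_ge0 // in h1 h2.
  have : 0 <= (s - t) * (- c - D) by rewrite mulr_ge0 ?subr_ge0.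
  lra.
Qed.

End Curves.

(** Closed balls are closed and convex. This confines Filippov velocities where the field is nearly
    constant. *)
Lemma closed_convex_hull_closed_ball (R : realType) (n : nat)
    (A : set 'rV[R]_n) w (r : R) : 0 < r ->
  A `<=` [set y | `|w - y| <= r] -> closed_convex_hull A `<=` [set y | `|w - y| <= r].
Proof.
move=> r0 Aw v; apply; split => //; split.
  have h : closed (closed_ball w r) by exact: closed_ball_closed.
  by rewrite closed_ballE in h; [exact: h|exact: r0].
move=> x y l; rewrite !inE /= => xw yw.
have k0 : 0 <= l%:num by rewrite ge0.
have k1 : l%:num <= 1 by rewrite le1.
pose k := l%:num; rewrite -/k in k0 k1.
have -> : w - conv l x y = k *: (w - x) + (1 - k) *: (w - y).
  rewrite !scalerBr addrACA -scalerDl -opprD.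
  by rewrite (_ : k + (1 - k) = 1) ?scale1r //; ring.
apply: le_trans (ler_normD _ _) _; rewrite !normrZ (ger0_norm k0).
rewrite ger0_norm ?subr_ge0 //.
have := ler_wpM2l k0 xw; have k2 : 0 <= 1 - k by rewrite subr_ge0.
have := ler_wpM2l k2 yw; lra.
Qed.

(** * The switching law and the decrease of [V] along Filippov solutions *)

Section Switching.
Context {R : realType} {n M m : nat}.
Notation mu := (@lebesgue_measure R).
Variables (f : 'I_M -> 'rV[R]_n -> 'rV[R]_n) (V W : 'rV[R]_n -> R).
Variables (Omega : 'I_m -> set 'rV[R]_n) (nu : 'rV[R]_n -> 'I_M).
Hypothesis f_lipschitz : forall i, [locally [lipschitz (f i) x | x in setT]].
Hypothesis V_smooth : piecewise_smooth V Omega.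
Hypothesis V_grad : has_boundary_gradients V Omega.
Hypothesis VW_clf : clf_pair f V W.
Implicit Types (x v : 'rV[R]_n) (j : 'I_m) (i q : 'I_M).

Lemma dirderiv_grad x v : differentiable V x -> dirderiv V x v = dotv (grad V x) v.
Proof.
move=> dV; rewrite -diff_gradE // -deriveE // /dirderiv /derive.
have /cvg_at_rightE -> : derivable V x v by exact: diff_derivable.
by under eq_fun do rewrite [x + _]addrC.
Qed.

(** In [Dset i] the index [i] minimises the slope of [V], and the control-Lyapunov inequality makes
    some slope at most [- W z]. *)
Lemma Dset_decrease j i z : Omega j z -> Dset f V Omega i z ->
  dotv (grad V z) (f i z) <= - W z.
Proof.
move=> jz [k _ [kz]]; have kj := piece_disjoint V_smooth kz jz.
rewrite piece_grad_in // => lt_min.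
have [_ _ _ _ /(_ z) min_le] := VW_clf.
have [_ _ _ _ /(_ j)[C1 _]] := V_smooth.
have dV : differentiable V z := (C1 z jz).1.
have [q qW] : exists q, dotv (grad V z) (f q z) <= - W z.
  apply: contrapT => /forallNP nq; move: min_le; apply/negP; rewrite -ltNge.
  apply/bigmin_gtP; split => [|q _]; first exact: ltry.
  by rewrite dirderiv_grad // lte_fin ltNge; apply/negP; exact: nq.
have [->|qi] := eqVneq i q; first exact: qW.
apply: le_trans qW; rewrite -lee_fin; apply: le_trans (ltW lt_min) _.
by apply: bigmin_le_cond; rewrite eq_sym.
Qed.

(** The inequality of [Dset_decrease] survives the limit: the gradient converges within piece [j],
    and [f i] and [W] are continuous. *)
Lemma closure_Dset_decrease j i x : closure (Omega j `&` Dset f V Omega i) x ->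
  dotv (piece_grad V Omega j x) (f i x) <= - W x.
Proof.
move=> clx; have [_ Wc _ _ _] := VW_clf.
have clj : closure (Omega j) x by apply: closureS clx; exact: subIsetl.
pose F := within (Omega j `&` Dset f V Omega i) (nbhs x).
have FF : ProperFilter F by exact: within_nbhs_proper.
have cg : grad V z @[z --> F] --> piece_grad V Omega j x.
  apply: cvg_trans (piece_grad_cvg V_smooth V_grad clj).
  by apply: cvg_app; apply: within_subset => z [].
have cf : f i z @[z --> F] --> f i x.
  apply: cvg_trans (locally_lipschitz_continuous (f_lipschitz i) (x := x)).
  by apply: cvg_app; exact: cvg_within.
have cW : - W z @[z --> F] --> - W x.
  apply: cvgN; apply: cvg_trans (Wc x); apply: cvg_app; exact: cvg_within.
have Fin : \forall z \near F, (Omega j `&` Dset f V Omega i) z by exact: withinT.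
apply: ler_cvg_to (cvg_dotv _ cg cf) cW _.
by apply: filterS Fin => z [jz iz]; exact: Dset_decrease jz iz.
Qed.

Hypothesis nu_law : switching_law f V Omega nu.
Hypothesis nu_admissible : admissible f V Omega.
Notation X := (closed_loop f nu).

(** By admissibility [x] is interior to some [Dset i]. Near [x] the closed loop is [f i], so the
    hulls lie in ever smaller balls around [f i x]. *)
Lemma filippov_map_off_bdD x v : filippov_map X x v ->
  ~ bdD f V Omega x -> Dset f V Omega (nu x) x /\ v = X x.
Proof.
have [cov null] := nu_admissible => Fx nbd.
have [i _ cli] : (\bigcup_i closure (Dset f V Omega i)) x by rewrite cov.
have int_i : nbhs x (Dset f V Omega i).
  by apply: contrapT => ni; apply: nbd; exists i.
have Di : Dset f V Omega i x := nbhs_singleton int_i.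
have nui := nu_law.1 i x Di; rewrite /closed_loop nui; split => //.
apply/eqP; rewrite eq_sym -subr_eq0 -normr_le0; apply/ler_addgt0Pr => e e0.
rewrite add0r.
have fe : \forall z \near x, `|f i x - f i z| <= e.
  have := locally_lipschitz_continuous (f_lipschitz i) (x := x).
  by move=> /cvgrPdist_le/(_ _ e0).
have /nbhs_normP[d /= d0 hd] : \forall z \near x, Dset f V Omega i z /\ `|f i x - f i z| <= e.
  by apply: filterS2 int_i fe.
apply: (closed_convex_hull_closed_ball e0 _ (Fx d _ d0 null)).
move=> _ [z [zx _] <-] /=.
have [Dz hz] : Dset f V Omega i z /\ `|f i x - f i z| <= e.
  by apply: hd; rewrite /= distrC; exact: le_lt_trans (norm_le_enorm _) zx.
by rewrite /closed_loop (nu_law.1 i z Dz).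
Qed.

(** Closure commutes with the finite union over the pieces. *)
Lemma closure_Dset_piece i x : closure (Dset f V Omega i) x ->
  exists j, closure (Omega j `&` Dset f V Omega i) x.
Proof.
move=> clx; apply: contrapT => /forallNP nj.
have h j : \forall z \near x, ~ (Omega j `&` Dset f V Omega i) z.
  have : \forall z \near x, (~` closure (Omega j `&` Dset f V Omega i)) z.
    by apply: open_nbhs_nbhs; split; [apply: closed_openC; exact: closed_closure|exact: nj].
  by apply: filterS => z nz /subset_closure /nz.
have [z [[k _ kz] nz]] := clx _ (filter_forall (nbhs_filter x) h).
by apply: (nz k); split; [exact: kz.1|exists k].
Qed.

Lemma Mset_closure j i x : Mset f V Omega j x i ->
  closure (Omega j `&` Dset f V Omega i) x.
Proof.
move=> [z hz zx] B /zx; rewrite /nbhs /= => -[N _ hN].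
by exists (z N); split; [exact: hz|apply: hN => /=].
Qed.

Variable alpha : 'rV[R]_n -> 'rV[R]_n -> 'I_M -> R.
Hypothesis alpha_sliding : sliding_coefficients f V Omega nu alpha.
Hypothesis boundary_decrease : forall x v,
  bdOmega Omega x -> bdD f V Omega x ->
  exists2 j, closure (Omega j) x &
    forall q, ~ Mset f V Omega j x q -> Ism_active f V Omega nu alpha x v q ->
      piece_dirderiv V Omega j x (f q x) <= - W x.

(* Off the boundaries of the pieces, [x] lies in a single open piece, so every
   [i] with [x] in the boundary of [Dset i] is in [Mset]. *)
Lemma sliding_piece x v : bdD f V Omega x -> exists2 j, closure (Omega j) x &
  forall i, Ism_active f V Omega nu alpha x v i ->
    dotv (piece_grad V Omega j x) (f i x) <= - W x.
Proof.
move=> xD; have [xO|xO] := pselect (bdOmega Omega x).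
  have [j clj hj] := boundary_decrease v xO xD; exists j => // i act.
  have [Mi|Mi] := pselect (Mset f V Omega j x i); last exact: hj.
  by apply: closure_Dset_decrease; exact: Mset_closure.
have [j clj] := closure_cover V_smooth x; exists j => // i [_ [cli _] _].
have jx : nbhs x (Omega j) by apply: contrapT => nj; apply: xO; exists j.
apply: closure_Dset_decrease => B Bx.
have [z [Dz [Bz jz]]] := cli _ (filterI Bx jx).
by exists z.
Qed.

(** If [v] is the field chosen by [nu], its region accumulates at [x] within some piece. Otherwise
    [x] is in [bdD] and [v] is a convex combination, treated by [sliding_piece]. *)
Lemma filippov_velocity_decrease x v : filippov_map X x v ->
  (v <> X x -> sliding_velocity f nu x v) -> exists2 j, closure (Omega j) x &
    dotv (piece_grad V Omega j x) v <= - W x.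
Proof.
move=> Fx slide; have [vX|vX] := pselect (v = X x).
  have clD : closure (Dset f V Omega (nu x)) x.
    have [xD|xD] := pselect (bdD f V Omega x); first by have [[]] := nu_law.2 x xD.
    by have [/subset_closure] := filippov_map_off_bdD Fx xD.
  have [j clj] := closure_Dset_piece clD; exists j; last first.
    by rewrite vX; exact: closure_Dset_decrease.
  by apply: closureS clj; exact: subIsetl.
have xD : bdD f V Omega x.
  by apply: contrapT => /(filippov_map_off_bdD Fx)[_ /vX].
have sv := slide vX; have [a0 a1 ->] := alpha_sliding xD sv.
have [j clj hj] := sliding_piece v xD; exists j => //.
(* The weights sum to one, so [- W x] is spread over the terms; a zero weight marks an inactive
   subsystem. *)
rewrite dotv_sumr -[leRHS]mul1r -a1 mulr_suml; apply: ler_sum => i /asboolP Ii.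
rewrite dotvZr; have [->|ai] := eqVneq (alpha x v i) 0; first by rewrite !mul0r.
by rewrite ler_wpM2l ?a0 // hj.
Qed.

(** The bound known for one piece extends to all pieces at the point by [ae_pieces_agree]. *)
Lemma filippov_ae_decrease phi : filippov_solution X phi ->
  {ae mu, forall t, 0 < t -> derivable phi t 1 /\
    forall j, closure (Omega j) (phi t) ->
      dotv (piece_grad V Omega j (phi t)) (derive1 phi t) <= - W (phi t)}.
Proof.
move=> sol; have [_ ae_sol] := sol.
(* [sliding_velocity] at time [t] requires [B] to be non-negligible around [t]; the times of [B]
   where this fails form a null set. *)
pose B : set R := [set s | 0 < s /\ derive1 phi s <> X (phi s)].
have ae_dense : {ae mu, forall t, B t -> forall e : R, 0 < e ->
    ~ mu.-negligible (B `&` [set s | `|s - t| < e])}.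
  apply: locally_negligible => t /= /not_implyP[_] /existsNP[e] /not_implyP[e0 /contrapT ne].
  by exists e => //; apply: negligibleS ne => s [/= /not_implyP[Bs _] st].
have agree := ae_pieces_agree V_smooth V_grad phi.
have FF := ae_filter_ringOfSetsType mu.
apply: filterS3 ae_sol ae_dense agree => t h1 h2 h3 t0.
have [dphi Fx] := h1 t0; split => // k clk.
have [j clj hj] : exists2 j, closure (Omega j) (phi t) &
    dotv (piece_grad V Omega j (phi t)) (derive1 phi t) <= - W (phi t).
  apply: filippov_velocity_decrease => // vX.
  exists phi, t; split => // e e0 ne; apply: (h2 _ e e0); first by split.
  by apply: negligibleS ne => s [[s0 sX] st]; split.
by rewrite (h3 dphi k j).
Qed.

(** The constant [c] stands in for the integral of [W] along the solution. *)
Lemma filippov_decrease phi (a b c : R) : filippov_solution X phi ->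
  0 <= a -> a <= b -> (forall t, a < t <= b -> c <= W (phi t)) ->
  V (phi b) <= V (phi a) - c * (b - a).
Proof.
move=> sol a0 ab Wc; have b0 : 0 <= b by exact: le_trans ab.
have ac : abs_continuous a b phi.
  exact: abs_continuous_sub a0 (lexx b) (sol.1 b b0).
apply: (curve_decrease V_smooth V_grad ab ac).
have FF := ae_filter_ringOfSetsType mu.
have := filippov_ae_decrease sol; apply: filterS => t h /andP[at_ tb].
have [|dphi hj] := h; first exact: le_lt_trans at_.
split => // j /hj hW; apply: le_trans hW _; rewrite lerN2; apply: Wc.
by rewrite at_.
Qed.

End Switching.

(** * Lyapunov's argument for stability and attractivity *)

Section Lyapunov.
Context {R : realType} {n M : nat}.
Variables (f : 'I_M -> 'rV[R]_n -> 'rV[R]_n) (V W : 'rV[R]_n -> R).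
Hypothesis VW_clf : clf_pair f V W.
Hypothesis V_cont : continuous V.
Implicit Types (x : 'rV[R]_n) (A : set 'rV[R]_n).

(** A closed subset of a bounded sublevel set is compact, so [h] attains its minimum there. *)
Lemma positive_lower_bound (h : 'rV[R]_n -> R) A (b : R) :
  continuous h -> closed A -> A `<=` [set x | V x <= b] ->
  (forall x, A x -> 0 < h x) -> exists2 c, 0 < c & forall x, A x -> c <= h x.
Proof.
have [_ _ _ bnd _] := VW_clf => hc cA Ab hpos.
have [A0|/set0P/negP/negPn/eqP A0] := pselect (A !=set0); last first.
  by exists 1 => // x; rewrite A0.
have cptA : compact A.
  apply: bounded_closed_compact cA; have [N [Nreal hN]] := bnd b.
  by exists N; split => // K NK x /Ab; exact: hN.
have [c cA' hmin] := EVT_min_rV A0 cptA (continuous_subspaceT hc).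
exists (h c) => [|x Ax]; first by apply: hpos; rewrite inE in cA'.
by apply: hmin; rewrite inE.
Qed.

Lemma enorm_continuous : continuous (@enorm R n).
Proof.
move=> x; have ci : z @[z --> nbhs x] --> x by move=> B.
have cd := cvg_dotv (nbhs_filter x) ci ci.
exact: cvg_comp cd (@sqrt_continuous R (dotv x x)).
Qed.

Lemma sublevel_enorm (eps : R) : 0 < eps ->
  exists2 c, 0 < c & forall x, V x < c -> enorm x < eps.
Proof.
have [_ _ [pos _] _ _] := VW_clf => eps0.
(* The condition [V x <= 1] makes [A] bounded; taking the minimum of [c] and 1 later enforces it. *)
pose A := [set x | V x <= 1] `&` [set x | eps <= enorm x].
have clA : closed A.
  apply: closedI.
    by apply: preimage_closed (@closed_le _ 1) => x _; exact: V_cont.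
  by apply: preimage_closed (@closed_ge _ eps) => x _; exact: enorm_continuous.
have [||c c0 hc] := positive_lower_bound (b := 1) V_cont clA.
- by move=> x [].
- move=> x [_ /= xe]; apply: (pos x _).1; apply/eqP => x0.
  by move: xe; rewrite x0 enorm0 leNgt eps0.
exists (Num.min c 1) => [|x]; first by rewrite lt_min c0 ltr01.
rewrite lt_min => /andP[xc x1]; rewrite ltNge; apply/negP => xe.
by have := hc x (conj (ltW x1) xe); rewrite leNgt xc.
Qed.

(** Since [V 0 = 0], the origin, where [W] may vanish, is outside the shell. *)
Lemma W_lower_bound (a b : R) : 0 < a ->
  exists2 c, 0 < c & forall x, a <= V x <= b -> c <= W x.
Proof.
have [_ Wc [pos V0] _ _] := VW_clf => a0.
pose A := [set x | a <= V x] `&` [set x | V x <= b].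
have clA : closed A.
  apply: closedI.
    by apply: preimage_closed (@closed_ge _ a) => x _; exact: V_cont.
  by apply: preimage_closed (@closed_le _ b) => x _; exact: V_cont.
have [||c c0 hc] := positive_lower_bound (b := b) Wc clA.
- by move=> x [].
- move=> x [/= xa _]; apply: (pos x _).2; apply/eqP => x0.
  by move: xa; rewrite x0 V0 leNgt a0.
by exists c => // x /andP[xa xb]; apply: hc.
Qed.

(** A sublevel set of [V] inside the [eps]-ball cannot be left, and it contains a ball around the
    origin. *)
Lemma lyapunov_stability (P : set (R -> 'rV[R]_n)) (eps : R) : 0 < eps ->
  (forall phi, P phi -> forall t, 0 <= t -> V (phi t) <= V (phi 0)) ->
  exists2 delta, 0 < delta & forall phi, P phi -> enorm (phi 0) <= delta ->
    forall t, 0 <= t -> enorm (phi t) < eps.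
Proof.
have [_ _ [_ V0] _ _] := VW_clf => eps0 dec.
have [c c0 hc] := sublevel_enorm eps0.
have /nbhs_normP[d /= d0 hd] : \forall x \near (0 : 'rV[R]_n), V x < c.
  by apply: (cvgr_lt (V 0) (@V_cont 0)); rewrite V0.
(* Halving turns the weak inequality on [phi 0] into the strict one of the ball. *)
exists (d / 2) => [|phi Pphi phi0 t t0]; first by rewrite divr_gt0.
apply: hc; apply: le_lt_trans (dec phi Pphi t t0) _; apply: hd => /=.
rewrite sub0r normrN; apply: le_lt_trans (norm_le_enorm _) _.
by apply: le_lt_trans phi0 _; rewrite ltr_pdivrMr // ltr_pMr // ltr1n.
Qed.

(** As long as [V] is at least [c], [W] is at least [w], so [V] would be negative at time [T]. Once
    below [c], [V] stays there. *)
Lemma lyapunov_attractivity (phi : R -> 'rV[R]_n) :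
  (forall a b c : R, 0 <= a -> a <= b -> (forall t, a < t <= b -> c <= W (phi t)) ->
     V (phi b) <= V (phi a) - c * (b - a)) ->
  phi t @[t --> +oo] --> (0 : 'rV[R]_n).
Proof.
have [[Vge0 Wge0] _ _ _ _] := VW_clf => dec.
have mono a b : 0 <= a -> a <= b -> V (phi b) <= V (phi a).
  move=> a0 ab; have := dec a b 0 a0 ab (fun t _ => Wge0 (phi t)).
  by rewrite mul0r subr0.
apply/cvgrPdist_lt => e e0.
have [c c0 hc] := sublevel_enorm e0.
have [w w0 hw] := W_lower_bound (V (phi 0)) c0.
(* With this [T], [V (phi 0) - w * T] equals [- w], which is negative. *)
pose T := V (phi 0) / w + 1.
have T0 : 0 <= T by rewrite addr_ge0 // divr_ge0 // ltW.
have VT : V (phi T) < c.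
  rewrite ltNge; apply/negP => cT.
  have := dec 0 T w (lexx 0) T0 _; rewrite subr0 leNgt => /(_ _)/negP[].
    move=> t /andP[t0 tT]; apply: hw; apply/andP; split.
      by apply: le_trans cT _; apply: mono => //; exact: ltW.
    by apply: mono => //; exact: ltW.
  apply: lt_le_trans (Vge0 _); rewrite /T mulrDr mulr1 mulrC divfK ?gt_eqF //.
  by rewrite opprD addrA subrr sub0r oppr_lt0.
exists T; split; first exact: num_real.
move=> t /ltW Tt; rewrite sub0r normrN; apply: le_lt_trans (norm_le_enorm _) _.
by apply: hc; apply: le_lt_trans VT; exact: mono.
Qed.

End Lyapunov.

(** * Global asymptotic stability of the closed loop including sliding motions *)

Unset Implicit Arguments.
Set Strict Implicit.
Set Printing Implicit Defensive.

Theorem theorem25 (R : realType) (n M m : nat)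
    (f : 'I_M -> 'rV[R]_n -> 'rV[R]_n) (V W : 'rV[R]_n -> R)
    (Omega : 'I_m -> set 'rV[R]_n) (nu : 'rV[R]_n -> 'I_M)
    (alpha : 'rV[R]_n -> 'rV[R]_n -> 'I_M -> R)
    (f_lipschitz : forall i, [locally [lipschitz (f i) x | x in setT]])
    (f_zero : forall i, f i 0 = 0)
    (V_smooth : piecewise_smooth V Omega)
    (V_grad : has_boundary_gradients V Omega)
    (VW_clf : clf_pair f V W)
    (nu_law : switching_law f V Omega nu)
    (nu_admissible : admissible f V Omega)
    (alpha_sliding : sliding_coefficients f V Omega nu alpha)
    (boundary_decrease : forall x v : 'rV[R]_n,
      bdOmega Omega x -> bdD f V Omega x ->
      exists2 j : 'I_m, closure (Omega j) x &
        forall q : 'I_M, ~ Mset f V Omega j x q ->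
          Ism_active f V Omega nu alpha x v q ->
          piece_dirderiv V Omega j x (f q x) <= - W x) :
  GAS_including_sliding f V Omega nu alpha.
Proof.
have Vc : continuous V by case: V_smooth.
have dec phi (a b c : R) : filippov_solution (closed_loop f nu) phi ->
    0 <= a -> a <= b -> (forall t, a < t <= b -> c <= W (phi t)) ->
    V (phi b) <= V (phi a) - c * (b - a).
  exact: (filippov_decrease f_lipschitz V_smooth V_grad VW_clf nu_law
    nu_admissible alpha_sliding boundary_decrease).
split=> [eps eps0|rho rho0 phi [sol _ _]]; last first.
  by apply: (lyapunov_attractivity VW_clf Vc) => a b c; exact: dec.
have [[_ W0] _ _ _ _] := VW_clf.
have [|d d0 hd] := lyapunov_stability VW_clf Vc
    (P := filippov_solution (closed_loop f nu)) eps0.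
  move=> phi sol t t0; have := dec phi 0 t 0 sol (lexx 0) t0 (fun s _ => W0 _).
  by rewrite mul0r subr0.
by exists d => // phi [sol phi0 _]; exact: hd.
Qed.
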